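(* Let $n$ and $m$ be positive integers with $m\geq n+1$, let $P=(x_1,y_1)\cdots(x_{n+1},y_{n+1})$ be an $(n,m)$-lattice path, and let $\Gamma=\Gamma_P:\{1,\ldots,m\}\to\mathcal{PL}(P)$ be as defined in the context. Then $PRML(\Gamma(r))=r-1$ for every $r\in\{1,\ldots,m\}$.
   Context: An $(n,m)$-lattice path is a sequence $Q=(u_1,v_1)\cdots(u_{n+1},v_{n+1})$ of vectors in $\mathbb{Z}^2$ such that $1-n\leq v_i\leq 1$, $\sum_i v_i=1$, $1\leq u_i\leq m-1$, $\sum_i u_i=m$. For such $Q$ put $a_0=b_0=0$, $a_i=\sum_{k=1}^{i}v_k$, $b_i=\sum_{k=1}^{i}u_k$; a minimum point is a point $(b_i,a_i)$ with $a_i\leq a_k$ for all $k\in\{0,\ldots,n+1\}$; the rightmost minimum point is the minimum point with largest $b_i$, and if it is $(b_i,a_i)$ then $RML(Q)=b_i$. A pointed $(n,m)$-lattice path is a pair $\dot{Q}=[Q;j]$ with $0\leq j\leq u_{n+1}-1$; its pointed rightmost minimum length is $PRML(\dot{Q})=RML(Q)+j$. For $P$ as in the claim and $i\in\{1,\ldots,n+1\}$, let $P_i=(x_{i+1},y_{i+1})\cdots(x_{n+1},y_{n+1})(x_1,y_1)\cdots(x_i,y_i)$ (so $P_{n+1}=P$), and $\dot{P}(i;j)=[P_i;j]$ for $0\leq j\leq x_i-1$; $\mathcal{PL}(P)=\{\dot{P}(i;j)\mid i\in\{1,\ldots,n+1\},\ 0\leq j\leq x_i-1\}$ (one element for each such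 pair $(i,j)$, $m$ in total). Let $s_i=\sum_{k=1}^{i}y_k$ and define a linear order $<_P$ on $\{1,\ldots,n+1\}$ by $i<_P j$ iff $s_i<s_j$, or $s_i=s_j$ and $i>j$. Let $i_0$ be the $<_P$-smallest element of $\{1,\ldots,n+1\}$ and let $\sigma_P=(\sigma_P(1),\ldots,\sigma_P(n+1))=(i_0,i_0-1,\ldots,1,n+1,n,\ldots,i_0+1)$. Define a linear order $\prec^*_P$ on $\mathcal{PL}(P)$ by $\dot{P}(i_1;j_1)\prec^*_P\dot{P}(i_2;j_2)$ iff either $\sigma_P^{-1}(i_1)<\sigma_P^{-1}(i_2)$, or $i_1=i_2$ and $j_1<j_2$. Let $\Gamma_P(r)$ be the $r$-th element of $\mathcal{PL}(P)$ in increasing $\prec^*_P$-order, for $r=1,\ldots,m$. *)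

(* Defs.v *)
From mathcomp Require Import all_boot all_order all_algebra.

Set Implicit Arguments.
Unset Strict Implicit.
Unset Printing Implicit Defensive.

Import Order.TTheory GRing.Theory Num.Theory.

Local Open Scope ring_scope.

(* A sequence of vectors is a [seq (int * int)]. Its steps, and the labels of *)
(* its rotations, are numbered from 1; its points are numbered from 0.        *)

Definition ustep (Q : seq (int * int)) (i : nat) : int :=
  (nth (0, 0) Q i.-1).1.

Definition vstep (Q : seq (int * int)) (i : nat) : int :=
  (nth (0, 0) Q i.-1).2.

Definition lattice_path (n m : nat) (Q : seq (int * int)) : Prop :=
  [/\ size Q = n.+1,
      forall i : nat, (1 <= i <= n.+1)%N -> 1 - n%:Z <= vstep Q i <= 1,
      \sum_(1 <= i < n.+2) vstep Q i = 1,
      forall i : nat, (1 <= i <= n.+1)%N -> 1 <= ustep Q i <= m%:Z - 1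
    & \sum_(1 <= i < n.+2) ustep Q i = m%:Z].

Definition height (Q : seq (int * int)) (i : nat) : int :=
  \sum_(1 <= k < i.+1) vstep Q k.

Definition abscissa (Q : seq (int * int)) (i : nat) : int :=
  \sum_(1 <= k < i.+1) ustep Q k.

Definition minimum_point (Q : seq (int * int)) (i : nat) : bool :=
  [forall k : 'I_(size Q).+1, height Q i <= height Q k].

(* The largest abscissa of a minimum point. The abscissas of a lattice path   *)
(* are nonnegative and a minimum point always exists, so the default value 0  *)
(* does not affect the maximum.                                               *)
Definition RML (Q : seq (int * int)) : int :=
  \big[Num.max/0]_(i < (size Q).+1 | minimum_point Q i) abscissa Q i.

(* The pair [(Q, j)] stands for the pointed path [Q; j].                      *)
Definition pointed_path (n m : nat) (Qj : seq (int * int) * nat) : Prop :=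
  lattice_path n m Qj.1 /\ Qj.2%:Z <= ustep Qj.1 n.+1 - 1.

Definition PRML (Qj : seq (int * int) * nat) : int := RML Qj.1 + Qj.2%:Z.

(* [rot i P] is P_i; in particular [rot (size P) P = P].                      *)
Definition rot_pointed (P : seq (int * int)) (ij : nat * nat) :
    seq (int * int) * nat :=
  (rot ij.1 P, ij.2).

(* The pairs (i, j) with 1 <= i <= n + 1 and 0 <= j <= x_i - 1, which index   *)
(* the elements of PL(P); the x_i are positive when P is a lattice path.      *)
Definition PL_labels (P : seq (int * int)) : seq (nat * nat) :=
  [seq (i, j) | i <- iota 1 (size P), j <- iota 0 `|ustep P i|%N].

Definition PL (P : seq (int * int)) : seq (seq (int * int) * nat) :=
  [seq rot_pointed P ij | ij <- PL_labels P].

Definition lt_index (P : seq (int * int)) (i j : nat) : bool :=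
  (height P i < height P j) || (height P i == height P j) && (j < i)%N.

(* The filtered sequence consists of the lt_index-smallest element only.      *)
Definition min_index (P : seq (int * int)) : nat :=
  head 0%N [seq i <- iota 1 (size P)
           | all (fun k => (k == i) || lt_index P i k) (iota 1 (size P))].

Definition sigma (P : seq (int * int)) : seq nat :=
  rev (iota 1 (min_index P))
  ++ rev (iota (min_index P).+1 (size P - min_index P)).

Definition sigma_inv (P : seq (int * int)) (i : nat) : nat :=
  (index i (sigma P)).+1.

Definition prec (P : seq (int * int)) (p q : nat * nat) : bool :=
  (sigma_inv P p.1 < sigma_inv P q.1)%N || (p.1 == q.1) && (p.2 < q.2)%N.

Definition preceq (P : seq (int * int)) (p q : nat * nat) : bool :=
  (p == q) || prec P p q.

(* The r-th element, counted from 1, of PL(P) in increasing order.            *)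
Definition Gamma (P : seq (int * int)) (r : nat) : seq (int * int) * nat :=
  rot_pointed P (nth (0, 0)%N (sort (preceq P) (PL_labels P)) r.-1).

Lemma sum_steps (f : int * int -> int) (n : nat) (Q : seq (int * int)) :
  size Q = n -> \sum_(1 <= i < n.+1) f (nth (0, 0) Q i.-1) = \sum_(p <- Q) f p.
Proof. by move=> <-; rewrite big_add1 /= [RHS](big_nth (0, 0)). Qed.

Lemma all_steps (a : pred (int * int)) (n : nat) (Q : seq (int * int)) :
  size Q = n ->
  all a Q <-> forall i : nat, (1 <= i <= n)%N -> a (nth (0, 0) Q i.-1).
Proof.
move=> <-; split=> [/all_nthP aQ [|i] // lti|aQ]; first exact: aQ.
by apply/(all_nthP (0, 0)) => i lti; apply: (aQ i.+1).
Qed.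

Lemma lattice_path_rot (n m i : nat) (P : seq (int * int)) :
  lattice_path n m P -> lattice_path n m (rot i P).
Proof.
case=> szP vP sumv uP sumu; have szr : size (rot i P) = n.+1 by rewrite size_rot.
have perm_r : perm_eq (rot i P) P by rewrite perm_rot.
split=> //.
- apply/(all_steps (fun p => 1 - n%:Z <= p.2 <= 1) szr).
  by rewrite (perm_all _ perm_r); apply/(all_steps _ szP).
- rewrite (sum_steps snd szr) (perm_big _ perm_r) /=.
  by rewrite -(sum_steps snd szP).
- apply/(all_steps (fun p => 1 <= p.1 <= m%:Z - 1) szr).
  by rewrite (perm_all _ perm_r); apply/(all_steps _ szP).
- rewrite (sum_steps fst szr) (perm_big _ perm_r) /=.
  by rewrite -(sum_steps fst szP).
Qed.

Lemma pointed_PL (n m : nat) (P : seq (int * int)) (Qj : seq (int * int) * nat) :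
  lattice_path n m P -> Qj \in PL P -> pointed_path n m Qj.
Proof.
move=> latP /mapP[_ /allpairsPdep[i [j [iP jP ->]]] ->].
split=> /=; first exact: lattice_path_rot.
case: (latP) => szP _ _ uP _; move: iP jP; rewrite !mem_iota !add0n add1n szP !ltnS.
case: i => // i; rewrite ltnS => lein ltj; have := uP i.+1 lein.
rewrite /ustep /= nth_cat size_drop szP subSS.
rewrite (_ : (n < n - i)%N = false); last by rewrite ltnNge leq_subr.
rewrite subKn // nth_take //; move: ltj; rewrite /ustep /=.
case: (nth _ _ _).1 => [k|k] //= ltj _.
by rewrite lerBrDr -PoszD lez_nat addn1.
Qed.

(* Hence no default value of [nth] is reached by [Gamma P r], 1 <= r <= m.    *)
Lemma size_PL (n m : nat) (P : seq (int * int)) :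
  lattice_path n m P -> size (PL P) = m.
Proof.
case=> szP _ _ uP sumu; rewrite size_map size_allpairs_dep szP.
apply/eqP; rewrite -eqz_nat -sumu sumnE big_map; apply/eqP.
rewrite -natz natr_sum /index_iota subSS subn0.
apply: eq_big_seq => i; rewrite mem_iota => /andP[i_gt0 lti].
have /andP[u_ge1 _]: 1 <= ustep P i <= m%:Z - 1 by apply: uP; rewrite i_gt0.
by rewrite size_iota natz gez0_abs // (le_trans _ u_ge1).
Qed.

(* Main.v *)
(* Let i_0 be the largest index minimizing s_i. The heights increase by 1 when *)
(* a rotation wraps around, so the rightmost minimum of P_i sits at the point  *)
(* coming from index i_0, whether i_0 is reached before or after wrapping.     *)
(* Hence RML(P_i) = x_{i+1} + ... + x_{i_0} (cyclically). Reading i along      *)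
(* sigma_P = (i_0, i_0 - 1, ...), the intervals [RML(P_i), RML(P_i) + x_i)     *)
(* are consecutive and tile [0, m), which is the claim.                        *)

Require Import Defs.
From mathcomp Require Import all_boot all_order all_algebra.
From mathcomp Require Import zify.

Set Implicit Arguments.
Unset Strict Implicit.
Unset Printing Implicit Defensive.

Import Order.TTheory GRing.Theory Num.Theory.

Local Open Scope ring_scope.

(** Because the total rise is 1, a point of P_i reached after the wrap lies 1 higher than the same
    point read in P. With i_0 the last minimum of P, this makes the image of i_0 the rightmost
    minimum of every P_i, so RML(P_i) is [offset P i] ([RML_rot]). Along [sigma P] each offset is
    the previous one plus the previous x_i, so offset plus j runs through 0, ..., m - 1
    ([offset_sigma_labels]). That enumeration of the labels is exactly their increasing order
    ([sort_PL_labels]), hence the r-th value is r - 1. *)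

(** * Partial sums, rotations and rightmost minima *)

Lemma sum_steps_take (f : int * int -> int) (Q : seq (int * int)) (i : nat) :
  (i <= size Q)%N ->
  \sum_(1 <= k < i.+1) f (nth (0, 0) Q k.-1) = \sum_(p <- take i Q) f p.
Proof.
move=> le_iQ; rewrite -(@sum_steps f i) ?size_takel // !big_add1 /=.
by apply: eq_big_nat => k /andP[_ lt_ki]; rewrite nth_take.
Qed.

Lemma heightE (Q : seq (int * int)) (i : nat) :
  (i <= size Q)%N -> height Q i = \sum_(p <- take i Q) p.2.
Proof. exact: (sum_steps_take snd). Qed.

Lemma abscissaE (Q : seq (int * int)) (i : nat) :
  (i <= size Q)%N -> abscissa Q i = \sum_(p <- take i Q) p.1.
Proof. exact: (sum_steps_take fst). Qed.

Lemma sum_take_rot (T : Type) (f : T -> int) (Q : seq T) (i k : nat) :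
  (i <= size Q)%N ->
  \sum_(p <- take k (rot i Q)) f p =
    (if (k <= size Q - i)%N then \sum_(p <- take (i + k) Q) f p
     else \sum_(p <- Q) f p + \sum_(p <- take (minn i (k - (size Q - i))) Q) f p)
    - \sum_(p <- take i Q) f p.
Proof.
move=> le_iQ; rewrite /rot take_cat size_drop.
case: (ltngtP k (size Q - i)) => [lt_k|gt_k|->].
- by rewrite takeD big_cat /= addrAC subrr add0r.
- rewrite /= big_cat /= -take_min minnC.
  have -> : \sum_(p <- Q) f p =
      \sum_(p <- take i Q) f p + \sum_(p <- drop i Q) f p.
    by rewrite -big_cat cat_take_drop.
  by rewrite [RHS]addrC -addrA addKr.
- rewrite /= subnn take0 cats0 subnKC // take_size.
  by rewrite -{2}(cat_take_drop i Q) big_cat /= addrAC subrr add0r.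
Qed.

(** Nonnegative horizontal steps make [abscissa] monotone, so the minimum point of largest index
    also has the largest abscissa. *)
Lemma RML_eq (Q : seq (int * int)) (k0 : nat) :
  all (fun p => 0 <= p.1) Q -> (k0 <= size Q)%N ->
  (forall k, (k <= size Q)%N -> height Q k0 <= height Q k) ->
  (forall k, (k0 < k <= size Q)%N -> height Q k0 < height Q k) ->
  RML Q = abscissa Q k0.
Proof.
move=> Q_ge0 le_k0 min_k0 rmin_k0.
have abs_mono i j : (i <= j <= size Q)%N -> abscissa Q i <= abscissa Q j.
  move=> /andP[le_ij le_jQ]; rewrite !abscissaE ?(leq_trans le_ij) //.
  rewrite -(subnKC le_ij) takeD big_cat lerDl /=.
  rewrite big_seq sumr_ge0 // => p /mem_take /mem_drop.
  exact: (allP Q_ge0).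
have abs0 : abscissa Q 0 = 0 by rewrite /abscissa big_geq.
apply/le_anti/andP; split.
  (* The default 0 of the maximum is the abscissa of the starting point. *)
  apply: bigmax_le => [|i /forallP/= min_i]; first by rewrite -abs0 abs_mono.
  apply: abs_mono; rewrite le_k0 andbT leqNgt; apply/negP => lt_i.
  have := rmin_k0 i; rewrite lt_i -ltnS ltn_ord => /(_ isT).
  by rewrite ltNge (min_i (Ordinal (n:=(size Q).+1) (m:=k0) le_k0)).
apply: (@le_bigmax_cond _ _ _ _ (Ordinal (n:=(size Q).+1) (m:=k0) le_k0)
  (minimum_point Q) (fun i : 'I__ => abscissa Q i)).
by apply/forallP => k; apply: min_k0; rewrite -ltnS.
Qed.

(** The point is that a smallest element exists, so that the [head] in [min_index] does not fall
    back on its default; it is found by induction on the number of indices. *)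
Lemma min_index_prop (P : seq (int * int)) : (0 < size P)%N ->
  [/\ (0 < min_index P <= size P)%N,
      forall k, (0 < k <= size P)%N -> height P (min_index P) <= height P k
    & forall k, (min_index P < k <= size P)%N ->
        height P (min_index P) < height P k].
Proof.
move=> P_gt0.
have [i iP min_i] : exists2 i, i \in iota 1 (size P) &
    all (fun k => (k == i) || lt_index P i k) (iota 1 (size P)).
  elim: (size P) P_gt0 => // [[|N] IHN] _; first by exists 1%N.
  have [//|i iN /allP min_i] := IHN.
  rewrite mem_iota in iN.
  (* On a tie the new index wins, since [lt_index] favours the larger one. *)
  have [le_i|lt_i] := leP (height P N.+2) (height P i).
    exists N.+2; first by rewrite mem_iota; lia.
    apply/allP => k; rewrite mem_iota => k_bnd.
    have [//|neq_k /=] := eqVneq k N.+2.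
    have /min_i : k \in iota 1 N.+1 by rewrite mem_iota; lia.
    rewrite /lt_index => /orP[/eqP ->|]; lia.
  exists i; first by rewrite mem_iota; lia.
  apply/allP => k; rewrite mem_iota => k_bnd.
  have [->|neq_k] := eqVneq k N.+2; first by rewrite /lt_index lt_i orbT.
  by apply: min_i; rewrite mem_iota; lia.
have : min_index P \in
    [seq i <- iota 1 (size P)
           | all (fun k => (k == i) || lt_index P i k) (iota 1 (size P))].
  (* The witness [i] shows that the filtered list is nonempty, so its head belongs to it. *)
  rewrite /min_index; move: (mem_filter
    (fun i => all (fun k => (k == i) || lt_index P i k) (iota 1 (size P)))
    i (iota 1 (size P))).
  by rewrite min_i iP; case: filter => //= a s _; rewrite mem_head.
rewrite mem_filter mem_iota => /andP[/allP min_m m_bnd].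
split=> [|k k_bnd|k k_bnd]; first by lia.
- have /min_m : k \in iota 1 (size P) by rewrite mem_iota; lia.
  by rewrite /lt_index => /orP[/eqP ->|]; lia.
- have /min_m : k \in iota 1 (size P) by rewrite mem_iota; lia.
  by rewrite /lt_index => /orP[/eqP|]; lia.
Qed.

Lemma perm_sigma (P : seq (int * int)) :
  (min_index P <= size P)%N -> perm_eq (sigma P) (iota 1 (size P)).
Proof.
move=> le_m; rewrite -(subnKC le_m) iotaD add1n.
by apply: perm_cat; rewrite perm_rev.
Qed.

(* x_{i+1} + ... + x_{i_0}, cyclically: the x-length of the steps preceding   *)
(* [i] in [sigma P]. When [i <= min_index P] no wrap-around occurs.           *)
Definition offset (P : seq (int * int)) (i : nat) : nat :=
  (\sum_(p <- take (min_index P) P) `|p.1|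
   + (if (min_index P < i)%N then \sum_(p <- P) `|p.1| else 0)
   - \sum_(p <- take i P) `|p.1|)%N.

Lemma sum_absz (s : seq (int * int)) : all (fun p => 0 <= p.1) s ->
  \sum_(p <- s) p.1 = (\sum_(p <- s) `|p.1|)%N%:Z.
Proof.
elim: s => [|p s IHs] /=; first by rewrite !big_nil.
by case/andP=> p_ge0 /IHs; rewrite !big_cons => ->; rewrite PoszD gez0_abs.
Qed.

Lemma sum_take_le (T : Type) (f : T -> nat) (s : seq T) (i j : nat) :
  (i <= j)%N ->
  (\sum_(p <- take i s) f p <= \sum_(p <- take j s) f p)%N.
Proof. by move=> /subnKC <-; rewrite takeD big_cat leq_addr. Qed.

(** The cases are whether i_0 is met before the wrap (i <= i_0) or after it (i_0 < i). *)
Lemma RML_rot (P : seq (int * int)) (i : nat) :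
  all (fun p => 0 <= p.1) P -> \sum_(p <- P) p.2 = 1 ->
  (0 < i <= size P)%N -> RML (rot i P) = (offset P i)%:Z.
Proof.
move=> P_ge0 sum1 i_bnd.
have [m_bnd min_m rmin_m] : _ := @min_index_prop P ltac:(lia).
have hrot k : (k <= size P)%N -> height (rot i P) k =
    (if (k <= size P - i)%N then height P (i + k)
     else 1 + height P (k - (size P - i))) - height P i.
  move=> le_k; rewrite heightE ?size_rot // sum_take_rot; last by lia.
  by case: ifP => ?; rewrite !heightE ?sum1 ?(minn_idPr _) //; lia.
have arot k : (k <= size P)%N -> abscissa (rot i P) k =
    (if (k <= size P - i)%N then abscissa P (i + k)
     else \sum_(p <- P) p.1 + abscissa P (k - (size P - i))) - abscissa P i.
  move=> le_k; rewrite abscissaE ?size_rot // sum_take_rot; last by lia.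
  by case: ifP => ?; rewrite !abscissaE ?(minn_idPr _) //; lia.
have absE k : (k <= size P)%N ->
    abscissa P k = (\sum_(p <- take k P) `|p.1|)%N%:Z.
  move=> le_k; rewrite abscissaE // sum_absz //.
  by apply/allP => p /mem_take; apply: (allP P_ge0).
set mi := min_index P in m_bnd min_m rmin_m *.
(* Position in [rot i P] of the point coming from i_0. *)
pose k0 := (if mi < i then mi + (size P - i) else mi - i)%N.
have le_k0 : (k0 <= size P)%N by rewrite /k0; case: ifP; lia.
have hk0 : height (rot i P) k0 =
    (if (mi < i)%N then 1 + height P mi else height P mi) - height P i.
  rewrite hrot // /k0; case: ltnP => lt_mi; last by rewrite ifT ?subnKC //; lia.
  by rewrite ifF ?addnK //; lia.
rewrite (@RML_eq _ k0) ?size_rot //; first last.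
(* To the right of [k0], a point on the same side of the wrap comes from an index beyond i_0; one
   that lies past the wrap when [k0] does not is higher by the extra 1. *)
- move=> k k_bnd; rewrite hk0 hrot; last by lia.
  have rmin1 := rmin_m (i + k)%N; have min2 := min_m (k - (size P - i))%N.
  have rmin2 := rmin_m (k - (size P - i))%N.
  by move: k_bnd; rewrite /k0; case: (ltnP mi i) => ?;
     case: (leqP k (size P - i)) => ? k_bnd; lia.
(* If i_0 < i, points before the wrap come from indices beyond i_0: strictly higher in P, hence by
   at least 1 in integers, which offsets the 1 gained by i_0. *)
- move=> k k_bnd; rewrite hk0 hrot //.
  have rmin1 := rmin_m (i + k)%N; have min2 := min_m (k - (size P - i))%N.
  have min1 := min_m (i + k)%N.
  by case: (ltnP mi i) => ?; case: (leqP k (size P - i)) => ?; lia.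
- by rewrite (perm_all _ (permEl (perm_rot i P))).
(* These bounds make the truncated subtraction in [offset] exact. *)
have d_mi := sum_take_le (fun p : int * int => `|p.1|%N) P (i := mi) (j := i).
have d_im := sum_take_le (fun p : int * int => `|p.1|%N) P (i := i) (j := mi).
have d_i := sum_take_le (fun p : int * int => `|p.1|%N) P (i := i) (j := size P).
rewrite take_size in d_i.
rewrite arot // /k0 /offset -/mi sum_absz //; case: ltnP => lt_mi.
  rewrite ifF ?addnK ?absE; lia.
rewrite ifT ?subnKC ?absE; lia.
Qed.

(** * Tiling of [0, m) by the intervals of offsets *)

(** The block of i is the interval [C - d i, C - d (i - 1)), so blocks read with i decreasing
    abut. *)
Lemma flatten_iota_rev (d : nat -> nat) (C a l : nat) :
  {homo d : i j / (i <= j)%N} -> (d (a + l) <= C)%N ->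
  flatten [seq iota (C - d i) (d i - d i.-1) | i <- rev (iota a.+1 l)]
    = iota (C - d (a + l)%N) (d (a + l)%N - d a).
Proof.
move=> d_mono; elim: l => [|l IHl] le_C; first by rewrite addn0 subnn.
have le1 : (d (a + l) <= d (a + l.+1))%N by apply: d_mono; lia.
have le2 : (d a <= d (a + l))%N by apply: d_mono; lia.
rewrite -[in rev _](addn1 l) iotaD rev_cat /= IHl; last by lia.
rewrite addSn -addnS /= addnS /= -addnS.
rewrite (_ : C - d (a + l)%N = C - d (a + l.+1) + (d (a + l.+1) - d (a + l)))%N;
  last by lia.
by rewrite -iotaD; congr iota; lia.
Qed.

Definition sigma_labels (P : seq (int * int)) : seq (nat * nat) :=
  [seq (i, j) | i <- sigma P, j <- iota 0 `|ustep P i|%N].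

(** With d the partial sums of the x_i, the run i_0, ..., 1 of [sigma P] tiles [0, d i_0) (take C =
    d i_0), and the run n+1, ..., i_0 + 1 tiles the rest (take C = d i_0 + d (n+1)). *)
Lemma offset_sigma_labels (P : seq (int * int)) :
  (0 < min_index P <= size P)%N ->
  [seq (offset P ij.1 + ij.2)%N | ij <- sigma_labels P]
    = iota 0 (\sum_(p <- P) `|p.1|).
Proof.
move=> m_bnd; pose d i := (\sum_(p <- take i P) `|p.1|)%N.
have d_mono : {homo d : i j / (i <= j)%N} by move=> i j; apply: sum_take_le.
have dS i : (0 < i <= size P)%N -> `|ustep P i|%N = (d i - d i.-1)%N.
  case: i => // i lt_i; rewrite /d (take_nth (0, 0)) // -cats1 big_cat /=.
  by rewrite addKn big_seq1.
have d_size : d (size P) = (\sum_(p <- P) `|p.1|)%N by rewrite /d take_size.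
have d0 : d 0%N = 0%N by rewrite /d take0 big_nil.
rewrite /sigma_labels map_flatten -map_comp.
rewrite (eq_in_map _ (fun i => iota (offset P i) (d i - d i.-1)) _).1; last first.
  move=> i; rewrite (perm_mem (perm_sigma _)) ?mem_iota; last by lia.
  move=> i_bnd /=; rewrite -map_comp dS; last by lia.
  by rewrite -[in RHS](addn0 (offset P i)) iotaDl.
rewrite /sigma map_cat flatten_cat -d_size.
set mi := min_index P in m_bnd *.
rewrite (eq_in_map _ (fun i => iota (d mi - d i) (d i - d i.-1)) _).1; last first.
  move=> i; rewrite mem_rev mem_iota => i_bnd.
  by rewrite /offset ifF ?addn0 //; lia.
rewrite flatten_iota_rev // add0n subnn d0 subn0.
rewrite (eq_in_map _
  (fun i => iota (d mi + d (size P) - d i) (d i - d i.-1)) _).1; last first.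
  move=> i; rewrite mem_rev mem_iota => i_bnd.
  by rewrite /offset ifT -?d_size //; lia.
rewrite flatten_iota_rev ?subnKC ?addnK ?leq_addl //; try lia.
have le_d : (d mi <= d (size P))%N by apply: d_mono; lia.
by rewrite -{2}(add0n (d mi)) -iotaD subnKC.
Qed.

(** * Sorting the labels *)

Lemma preceq_trans (P : seq (int * int)) : transitive (preceq P).
Proof.
move=> [b b'] [a a'] [c c']; rewrite /preceq /prec /= !xpair_eqE.
by have [->|?] := eqVneq a b; have [->|?] := eqVneq b c; lia.
Qed.

Lemma preceq_anti (P : seq (int * int)) : antisymmetric (preceq P).
Proof.
move=> [a a'] [b b']; rewrite /preceq /prec /= !xpair_eqE.
have [->|?] := eqVneq a b; rewrite ?eqxx => H; last by lia.
by congr pair; lia.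
Qed.

(** Totality is restricted to indices in [sigma P]: all others share the same [sigma_inv]. *)
Lemma preceq_total (P : seq (int * int)) :
  {in [pred p | p.1 \in sigma P] &, total (preceq P)}.
Proof.
move=> [a a'] [b b']; rewrite !inE /= => aP bP.
rewrite /preceq /prec /sigma_inv /= !xpair_eqE.
have [->|neq_ab] := eqVneq a b; first by lia.
have : index a (sigma P) != index b (sigma P).
  by apply: contra neq_ab => /eqP/index_inj->.
lia.
Qed.

Lemma map_index_uniq (T : eqType) (s : seq T) :
  uniq s -> [seq index x s | x <- s] = iota 0 (size s).
Proof.
move=> s_uniq; case: s s_uniq => // x0 s s_uniq.
apply: (@eq_from_nth _ 0%N) => [|i]; rewrite size_map ?size_iota // => lt_i.
by rewrite (nth_map x0) // index_uniq // nth_iota.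
Qed.

Lemma sorted_sigma_labels (P : seq (int * int)) :
  uniq (sigma P) -> sorted (preceq P) (sigma_labels P).
Proof.
move=> s_uniq; rewrite (sorted_pairwise (@preceq_trans P)).
have : pairwise (fun i j => sigma_inv P i < sigma_inv P j)%N (sigma P).
  rewrite -(pairwise_map (index^~ (sigma P)) ltn) map_index_uniq //.
  by rewrite -(sorted_pairwise ltn_trans) iota_ltn_sorted.
(* The induction generalises the list of indices while [sigma_inv P] stays fixed. *)
rewrite /sigma_labels; elim: {s_uniq}(sigma P) => //= i s IHs /andP[lt_i /IHs].
rewrite pairwise_cat => ->; rewrite andbT; apply/andP; split.
  apply/allrelP => p q /mapP[j _ ->] /allpairsPdep[k [l [ks _ ->]]].
  by rewrite /preceq /prec /= (allP lt_i) ?orbT.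
rewrite pairwise_map; apply: sub_pairwise (_ : pairwise ltn _) => [j k lt_jk|].
  by rewrite /preceq /prec /= eqxx [(j < k)%N]lt_jk !orbT.
by rewrite -(sorted_pairwise ltn_trans) iota_ltn_sorted.
Qed.

(** Two sorted permutations of one list agree under an antisymmetric transitive relation. *)
Lemma sort_PL_labels (P : seq (int * int)) : (min_index P <= size P)%N ->
  sort (preceq P) (PL_labels P) = sigma_labels P.
Proof.
move=> le_m; have perm_s := perm_sigma le_m.
have perm_L : perm_eq (PL_labels P) (sigma_labels P).
  by rewrite perm_sym; apply/perm_flatten/perm_map.
apply: (sorted_eq (@preceq_trans P) (@preceq_anti P)).
- apply: (sort_sorted_in (@preceq_total P)); apply/allP => p.
  by case/allpairsPdep=> i [j [iP _ ->]]; rewrite inE /= (perm_mem perm_s).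
- by apply: sorted_sigma_labels; rewrite (perm_uniq perm_s) iota_uniq.
- by rewrite perm_sort.
Qed.

Theorem theorem3p12 (n m : nat) (n_gt0 : (0 < n)%N) (m_gt0 : (0 < m)%N)
    (n_lt_m : (n.+1 <= m)%N) (P : seq (int * int)) (latP : lattice_path n m P)
    (r : nat) (r_bnd : (1 <= r <= m)%N) :
  PRML (Gamma P r) = r%:Z - 1.
Proof.
have [szP _ sumv uP sumu] := latP.
have P_ge0 : all (fun p => 0 <= p.1) P.
  by apply/(all_steps _ szP) => i /uP/andP[u_ge1 _]; apply: le_trans u_ge1.
have sum2 : \sum_(p <- P) p.2 = 1 by rewrite -(sum_steps snd szP).
have sum1 : (\sum_(p <- P) `|p.1|)%N = m.
  by apply/eqP; rewrite -eqz_nat -sum_absz // -(sum_steps fst szP) -sumu.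
have [m_bnd _ _] : _ := @min_index_prop P ltac:(lia).
have labelsE := offset_sigma_labels m_bnd.
have size_L : size (sigma_labels P) = m.
  by rewrite -(size_map (fun ij => offset P ij.1 + ij.2)%N) labelsE size_iota.
rewrite /Gamma sort_PL_labels; last by lia.
have lt_r : (r.-1 < size (sigma_labels P))%N by lia.
(* For the selected label, [nth_map] will give offset plus j equal to r - 1, and membership the
   range of i that [RML_rot] requires. *)
have := mem_nth (0, 0)%N lt_r; have := nth_map (0, 0)%N 0%N
  (fun ij => offset P ij.1 + ij.2)%N lt_r.
rewrite labelsE sum1 nth_iota; last by lia.
case: nth => i j /= rE /allpairsPdep[i1 [j1 [iP _ [i_eq _]]]].
rewrite -i_eq (perm_mem (perm_sigma _)) ?mem_iota in iP; last by lia.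
by rewrite /PRML /= RML_rot //; lia.
Qed.
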